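(* Let $n>2$ and $t$ be two positive integers. Then \[\varphi(C_n\boxdot K_t)=\begin{cases} t+2, & \text{if } n\leq t+1,\\ n, & \text{if } t+2\leq n\leq 2t+3,\\ 2t+3, & \text{otherwise}. \end{cases}\]
   Context: All graphs are finite and simple. $C_n$ and $K_n$ denote respectively the cycle and the complete graph with $n$ vertices. The subdivision graph $S(G)$ of a graph $G$ is obtained by inserting one new vertex into every edge of $G$. For graphs $G$ and $H$, with $V(G)=\{u_0,\ldots,u_{m-1}\}$, the subdivision-vertex neighbourhood corona (SVN corona) $G\boxdot H$ is the graph obtained from $S(G)$ by adding $m$ vertex-disjoint copies of $H$ (one for each $u_i$) and joining, for each $i$, every vertex of $N_{S(G)}(u_i)$ (the neighbourhood of $u_i$ in $S(G)$) to every vertex of the copy of $H$ associated with $u_i$. A $b$-chromatic coloring of a graph with $k$ colors is a proper coloring with colors $0,\ldots,k-1$ such that, for each color $i$, there is a vertex (a $b$-vertex) of color $i$ having, for each color $j\neq i$, a neighbour of color $j$. The $b$-chromatic number $\varphi(G)$ is the maximum $k$ for which $G$ has a $b$-chromatic coloring with $k$ colors. *)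

(* Defs.v *)
From mathcomp Require Import all_boot.

Set Implicit Arguments.
Unset Strict Implicit.
Unset Printing Implicit Defensive.

Record sgraph := SGraph {
  svertex :> finType;
  adj : rel svertex;
  adj_sym : symmetric adj;
  adj_irrefl : irreflexive adj }.

(* On [n] vertices, with i adjacent to i + 1 modulo n.  The disequality only
   matters for n = 1, where it removes a loop; for n >= 3 this is the cycle. *)
Definition cycle_adj (n : nat) : rel 'I_n :=
  fun i j => (i != j) && ((j == ordS i) || (i == ordS j)).

Lemma cycle_adj_sym n : symmetric (@cycle_adj n).
Proof. by move=> i j; rewrite /cycle_adj eq_sym orbC. Qed.

Lemma cycle_adj_irrefl n : irreflexive (@cycle_adj n).
Proof. by move=> i; rewrite /cycle_adj eqxx. Qed.

Definition cycle_graph (n : nat) : sgraph :=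
  SGraph (@cycle_adj_sym n) (@cycle_adj_irrefl n).

Definition complete_adj (n : nat) : rel 'I_n := fun i j => i != j.

Lemma complete_adj_sym n : symmetric (@complete_adj n).
Proof. by move=> i j; rewrite /complete_adj eq_sym. Qed.

Lemma complete_adj_irrefl n : irreflexive (@complete_adj n).
Proof. by move=> i; rewrite /complete_adj eqxx. Qed.

Definition complete_graph (n : nat) : sgraph :=
  SGraph (@complete_adj_sym n) (@complete_adj_irrefl n).

Definition is_edge (G : sgraph) : pred {set G} :=
  fun e => [exists x, exists y, adj x y && (e == [set x; y])].

Definition edge (G : sgraph) : finType := {e : {set G} | is_edge e}.

(* [inl u] is the original vertex u, [inr e] the vertex inserted into e. *)
Definition subdiv_adj (G : sgraph) : rel (G + edge G)%type :=
  fun a b => match a, b with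
  | inl u, inr e | inr e, inl u => u \in val e
  | _, _ => false
  end.

Lemma subdiv_adj_sym G : symmetric (@subdiv_adj G).
Proof. by case=> a [] b. Qed.

Lemma subdiv_adj_irrefl G : irreflexive (@subdiv_adj G).
Proof. by case. Qed.

Definition subdivision (G : sgraph) : sgraph :=
  SGraph (@subdiv_adj_sym G) (@subdiv_adj_irrefl G).

(* [inl s] is the vertex s of S(G), and [inr (u, h)] is the vertex h in the
   copy of H associated with the original vertex u of G. *)
Definition svn_adj (G H : sgraph) : rel (subdivision G + G * H)%type :=
  fun a b => match a, b with
  | inl s, inl s' => adj s s'
  | inl s, inr (u, _) | inr (u, _), inl s =>
      @adj (subdivision G) (inl u) s
  | inr (u, h), inr (u', h') => (u == u') && adj h h'
  end.

Lemma svn_adj_sym G H : symmetric (@svn_adj G H).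
Proof.
case=> [s|[u h]] [s'|[u' h']] //; first exact: adj_sym.
by rewrite /svn_adj eq_sym adj_sym.
Qed.

Lemma svn_adj_irrefl G H : irreflexive (@svn_adj G H).
Proof.
case=> [s|[u h]]; first exact: adj_irrefl.
by rewrite /svn_adj adj_irrefl andbF.
Qed.

Definition svn_corona (G H : sgraph) : sgraph :=
  SGraph (@svn_adj_sym G H) (@svn_adj_irrefl G H).

Definition proper_coloring (G : sgraph) (k : nat) (f : G -> 'I_k) : bool :=
  [forall x, forall y, adj x y ==> (f x != f y)].

Definition b_vertex (G : sgraph) (k : nat) (f : G -> 'I_k) (x : G) : bool :=
  [forall j, (j != f x) ==> [exists y, adj x y && (f y == j)]].

Definition b_coloring (G : sgraph) (k : nat) (f : G -> 'I_k) : bool :=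
  proper_coloring f && [forall i, exists x, (f x == i) && b_vertex f x].

Definition b_colorable (G : sgraph) (k : nat) : bool :=
  [exists f : {ffun G -> 'I_k}, b_coloring f].

(* Every color of a b-coloring is used, so the bound #|G| on k loses nothing;
   see [leq_b_chromatic] and [b_chromatic_attained]. *)
Definition b_chromatic (G : sgraph) : nat :=
  \max_(k < #|G|.+1 | b_colorable G k) k.

Lemma b_colorable_leq_card (G : sgraph) k : b_colorable G k -> k <= #|G|.
Proof.
case/existsP=> f /andP[_ /forallP fb].
have fs (i : 'I_k) : i \in codom f.
  by have /existsP[x /andP[/eqP <- _]] := fb i; apply: codom_f.
rewrite -[k in k <= _]card_ord -(size_codom f) cardE.
by apply: uniq_leq_size (enum_uniq _) _ => i _; apply: fs.
Qed.

Lemma leq_b_chromatic (G : sgraph) k : b_colorable G k -> k <= b_chromatic G.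
Proof.
move=> Gk; have kG : k < #|G|.+1 by rewrite ltnS b_colorable_leq_card.
exact: (leq_bigmax_cond (Ordinal kG)).
Qed.

(* A color-minimal proper coloring is a b-coloring. *)
Lemma b_colorable_exists (G : sgraph) : exists k, b_colorable G k.
Proof.
pose P k := [exists f : {ffun G -> 'I_k}, proper_coloring f].
have exP : exists k, P k.
  exists #|G|; apply/existsP; exists [ffun x => enum_rank x].
  apply/forallP=> x; apply/forallP=> y; apply/implyP=> xy.
  rewrite !ffunE (inj_eq enum_rank_inj).
  by apply: contraTneq xy => ->; rewrite adj_irrefl.
case: (ex_minnP exP) => k /existsP[f fP] kmin; exists k.
apply/existsP; exists f; rewrite /b_coloring fP /=.
apply/forallP=> i; apply: contraT => /existsPn noi.
have miss x : exists j, (f x == i) ==>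
    (j != i) && [forall y, adj x y ==> (f y != j)].
  have [fxi|fxi] := eqVneq (f x) i; last by exists i.
  have := noi x; rewrite fxi eqxx /= negb_forall => /existsP[j].
  rewrite fxi negb_imply => /andP[ji /existsPn nj]; exists j.
  by rewrite ji; apply/forallP=> y; have := nj y; rewrite negb_and implybE.
have [m mP] : exists m : G -> 'I_k, forall x, f x = i ->
    m x != i /\ forall y, adj x y -> f y != m x.
  exists (fun x => xchoose (miss x)) => x /eqP fx.
  have /implyP/(_ fx)/andP[mi /forallP nm] := xchooseP (miss x).
  by split=> // y; apply/implyP.
pose g x := if f x == i then m x else f x.
have gi x : i != g x.
  by rewrite /g eq_sym; have [/mP[]|//] := eqVneq (f x) i.
have gadj x y : adj x y -> g x != g y.
  move=> xy; have fxy : f x != f y.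
    by move/forallP/(_ x)/forallP/(_ y)/implyP: fP; apply.
  rewrite /g; have [fx|_] := eqVneq (f x) i.
    have [_ mx] := mP x fx; rewrite ifN; first by rewrite eq_sym mx.
    by rewrite -fx eq_sym.
  have [fy|//] := eqVneq (f y) i.
  by have [_ my] := mP y fy; apply: my; rewrite adj_sym.
have Pk1 : P k.-1.
  have gu x : {j | g x = lift i j}.
    by case: (unlift_some (gi x)) => j gj _; exists j.
  apply/existsP; exists [ffun x => sval (gu x)].
  apply/forallP=> x; apply/forallP=> y; apply/implyP=> /gadj gxy.
  rewrite !ffunE; apply: contra gxy => /eqP guxy.
  by apply/eqP; rewrite (svalP (gu x)) guxy -(svalP (gu y)).
by move: (kmin _ Pk1); rewrite leqNgt ltn_predL (leq_ltn_trans (leq0n i) (ltn_ord i)).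
Qed.

Lemma b_chromatic_attained (G : sgraph) : b_colorable G (b_chromatic G).
Proof.
have [k Gk] := b_colorable_exists G.
have kG : k < #|G|.+1 by rewrite ltnS b_colorable_leq_card.
rewrite /b_chromatic (bigmax_eq_arg (Ordinal kG)) //.
by case: arg_maxnP.
Qed.

(* Main.v *)
(* Root vertices have degree 2, copy vertices degree t + 1, and the n vertices
   inserted into the edges degree 2t + 2.  So k <= 2t + 3 for every b-coloring
   with k colors, and if k > t + 2 then all b-vertices are edge vertices, so
   that k <= n.  Explicit colorings attain these bounds: for n >= t + 2 they
   come from a cyclic difference pattern that makes k consecutive edge vertices
   b-vertices. *)

Require Import Defs.
From mathcomp Require Import all_boot.
From mathcomp Require Import zify.

Set Implicit Arguments.
Unset Strict Implicit.
Unset Printing Implicit Defensive.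

(** * Criteria for b-colorings of arbitrary graphs *)

Ltac if_lia := repeat
  match goal with
  | |- context [if ?b then _ else _] => let H := fresh in destruct b eqn:H
  | _ : context [if ?b then _ else _] |- _ => let H := fresh in destruct b eqn:H
  end; lia.

(** Colors are plain natural numbers here, so that explicit colorings can be checked by linear
    arithmetic. *)
Lemma b_colorable_nat (G : sgraph) k (f : G -> nat) :
    (forall x, f x < k) ->
    (forall x y, adj x y -> f x <> f y) ->
    (forall c, c < k -> exists2 x, f x = c &
       forall c', c' < k -> c' <> c -> exists2 y, adj x y & f y = c') ->
  b_colorable G k.
Proof.
move=> fk fP fb; apply/existsP; exists [ffun x => Ordinal (fk x)].
apply/andP; split.
  apply/forallP=> x; apply/forallP=> y; apply/implyP=> xy.
  by rewrite !ffunE -val_eqE; apply/eqP/fP.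
apply/forallP=> i; have [x fx xb] := fb i (ltn_ord i).
apply/existsP; exists x; rewrite ffunE -val_eqE /= fx eqxx /=.
apply/forallP=> j; apply/implyP; rewrite ffunE -val_eqE /= fx => /eqP ji.
have [y xy fy] := xb j (ltn_ord j) ji.
by apply/existsP; exists y; rewrite xy ffunE -val_eqE /= fy eqxx.
Qed.

Lemma b_vertex_leq_size (G : sgraph) k (f : G -> 'I_k) x (s : seq G) :
  b_vertex f x -> (forall y, adj x y -> y \in s) -> k <= (size s).+1.
Proof.
move=> /forallP xb sP; rewrite -[k in k <= _]card_ord cardE -(size_map f s).
apply: (uniq_leq_size (enum_uniq _) (s2 := f x :: map f s)) => j _.
rewrite inE; have [//|jx] := eqVneq j (f x).
have /existsP[y /andP[xy /eqP <-]] := implyP (xb j) jx.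
by rewrite map_f ?sP ?orbT.
Qed.

Lemma val_ordS n (i : 'I_n) : ordS i = (if i.+1 < n then i.+1 else 0) :> nat.
Proof.
rewrite /=; case: ltnP => [/modn_small //|le_n].
by have -> : i.+1 = n by [move: (ltn_ord i); lia]; rewrite modnn.
Qed.

(** * Vertices, adjacency and colorings of the corona *)

Section CycleCorona.

Variables (n t : nat) (n_gt2 : 2 < n).

Let G := svn_corona (cycle_graph n) (complete_graph t).

Lemma ordS_neq (i : 'I_n) : i != ordS i.
Proof.
by apply/eqP=> /(congr1 (@nat_of_ord n)); rewrite val_ordS; move: n_gt2; if_lia.
Qed.

Lemma cycle_edge_subproof (i : 'I_n) :
  @is_edge (cycle_graph n) [set i; ordS i].
Proof.
apply/existsP; exists i; apply/existsP; exists (ordS i).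
by rewrite eqxx andbT /adj /= /cycle_adj ordS_neq eqxx.
Qed.

Definition cycle_edge (i : 'I_n) : edge (cycle_graph n) :=
  exist (fun e => is_edge e) _ (cycle_edge_subproof i).

Lemma mem_cycle_edge (i u : 'I_n) :
  (u \in val (cycle_edge i)) = (u == i) || (u == ordS i).
Proof. by rewrite !inE. Qed.

Lemma cycle_edge_surj e : exists i, cycle_edge i == e.
Proof.
case: e => e /[dup] /existsP[x /existsP[y /andP[xy /eqP def_e]]] eP.
case/andP: xy => _ /orP[]/eqP xy; [exists x | exists y]; rewrite -val_eqE /=.
  by rewrite def_e xy.
by rewrite def_e xy setUC.
Qed.

(** If [i] and [j] were distinct, each would be the successor of the other, which [2 < n]
    excludes. *)
Lemma cycle_edge_inj : injective cycle_edge.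
Proof.
move=> i j ij.
have : j \in val (cycle_edge i) by rewrite ij mem_cycle_edge eqxx.
have : i \in val (cycle_edge j) by rewrite -ij mem_cycle_edge eqxx.
rewrite !mem_cycle_edge.
have ordSE (x y : 'I_n) : (x == ordS y) = (x == ordS y :> nat) by [].
rewrite !ordSE !val_ordS -!val_eqE /= => ij' ji.
apply: val_inj => /=; move: ij' ji.
by move: (ltn_ord i) (ltn_ord j) n_gt2; if_lia.
Qed.

Definition edge_index (e : edge (cycle_graph n)) : 'I_n :=
  xchoose (cycle_edge_surj e).

Lemma edge_indexK : cancel edge_index cycle_edge.
Proof. by move=> e; apply/eqP/(xchooseP (cycle_edge_surj e)). Qed.

Lemma cycle_edgeK : cancel cycle_edge edge_index.
Proof. by move=> i; apply: cycle_edge_inj; rewrite edge_indexK. Qed.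

Definition root_vx (i : 'I_n) : G := inl (inl i).
Definition edge_vx (i : 'I_n) : G := inl (inr (cycle_edge i)).
Definition copy_vx (i : 'I_n) (j : 'I_t) : G := inr (i, j).

Lemma svn_cycleP (P : G -> Prop) :
    (forall i, P (root_vx i)) -> (forall i, P (edge_vx i)) ->
    (forall i j, P (copy_vx i j)) ->
  forall x, P x.
Proof.
move=> Pu Pe Pc [[u|e]|[i j]]; [exact: Pu| |exact: Pc].
by rewrite -(edge_indexK e); apply: Pe.
Qed.

Lemma adj_root_edge i k :
  adj (root_vx i) (edge_vx k) = (i == k) || (i == ordS k).
Proof. exact: mem_cycle_edge. Qed.

Lemma adj_copy_edge i j k :
  adj (copy_vx i j) (edge_vx k) = (i == k) || (i == ordS k).
Proof. exact: mem_cycle_edge. Qed.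

Lemma adj_copy i j i' j' :
  adj (copy_vx i j) (copy_vx i' j') = (i == i') && (j != j').
Proof. by []. Qed.

Lemma eq_ordS_pred (i k : 'I_n) : (i == ordS k) = (k == ord_pred i).
Proof. by apply/eqP/eqP=> ->; rewrite ?ordSK ?ord_predK. Qed.

(** [U], [E] and [C] color the roots, edge vertices and copies. A b-vertex is sought among edge or
    copy vertices; the copy is written [ordS ij.1] so that its two edge vertices are [ij.1] and
    [ordS ij.1], without predecessors. *)
Lemma b_colorable_svn_cycle k (U E : 'I_n -> nat) (C : 'I_n -> 'I_t -> nat) :
    (forall i, U i < k) -> (forall i, E i < k) -> (forall i j, C i j < k) ->
    (forall i, U i <> E i) -> (forall i, U (ordS i) <> E i) ->
    (forall i j, C i j <> E i) -> (forall i j, C (ordS i) j <> E i) ->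
    (forall i, injective (C i)) ->
    (forall c, c < k ->
       (exists2 i, E i = c & forall c', c' < k -> c' <> c ->
          [\/ c' = U i, c' = U (ordS i), exists j, c' = C i j
            | exists j, c' = C (ordS i) j]) \/
       (exists2 ij, C (ordS ij.1) ij.2 = c & forall c', c' < k -> c' <> c ->
          [\/ c' = E ij.1, c' = E (ordS ij.1)
            | exists j, c' = C (ordS ij.1) j])) ->
  b_colorable G k.
Proof.
move=> Uk Ek Ck UE USE CE CSE Cinj bP.
pose f (x : G) := match x with
  | inl (inl i) => U i | inl (inr e) => E (edge_index e)
  | inr (i, j) => C i j end.
have fE i : f (edge_vx i) = E i by rewrite /= cycle_edgeK.
(* Every adjacency not inside a copy joins an edge vertex to a root or copy vertex. *)
have fxe x i : (exists i', x = root_vx i' \/ exists j, x = copy_vx i' j) ->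
    adj x (edge_vx i) -> f x <> f (edge_vx i).
  rewrite fE; case=> i' [->|[j ->]].
    by rewrite adj_root_edge => /orP[]/eqP->; [apply: UE | apply: USE].
  by rewrite adj_copy_edge => /orP[]/eqP->; [apply: CE | apply: CSE].
apply: (@b_colorable_nat G k f).
- by apply: svn_cycleP => [i|i|i j]; [apply: Uk | rewrite fE | apply: Ck].
- apply: svn_cycleP => [i|i|i j]; apply: svn_cycleP => [i'|i'|i' j'] //.
  + by apply: fxe; exists i; left.
  + by rewrite adj_sym => xy; apply/nesym/fxe => //; exists i'; left.
  + by rewrite adj_sym => xy; apply/nesym/fxe => //; exists i'; right; exists j'.
  + by apply: fxe; exists i; right; exists j.
  + rewrite adj_copy => /andP[/eqP-> /eqP jj'] /= /Cinj.
    exact: jj'.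
- move=> c /bP[[i Eic ib]|[[i j] Cic ijb]].
    exists (edge_vx i) => [|c' c'k c'c]; first by rewrite fE.
    case: (ib c' c'k c'c) => [->|->|[j ->]|[j ->]].
    + by exists (root_vx i); rewrite // adj_sym adj_root_edge eqxx.
    + by exists (root_vx (ordS i)); rewrite // adj_sym adj_root_edge eqxx orbT.
    + by exists (copy_vx i j); rewrite // adj_sym adj_copy_edge eqxx.
    + by exists (copy_vx (ordS i) j); rewrite // adj_sym adj_copy_edge eqxx orbT.
  exists (copy_vx (ordS i) j) => // c' c'k c'c.
  case: (ijb c' c'k c'c) => [->|->|[j' c'j']].
  + by exists (edge_vx i); rewrite ?fE // adj_copy_edge eqxx orbT.
  + by exists (edge_vx (ordS i)); rewrite ?fE // adj_copy_edge eqxx.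
  + exists (copy_vx (ordS i) j'); rewrite // adj_copy eqxx /=.
    by apply: contra_notN c'c => /eqP jj'; rewrite c'j' -jj'.
Qed.

(** * Upper bounds from degrees *)

Lemma b_vertex_root k (f : G -> 'I_k) i : b_vertex f (root_vx i) -> k <= 3.
Proof.
move/(@b_vertex_leq_size _ _ _ _ [:: edge_vx i; edge_vx (ord_pred i)]); apply.
apply: svn_cycleP => // j; rewrite adj_root_edge eq_ordS_pred eq_sym !inE.
by case/orP=> /eqP->; rewrite eqxx ?orbT.
Qed.

Lemma b_vertex_copy k (f : G -> 'I_k) i j :
  b_vertex f (copy_vx i j) -> k <= t + 2.
Proof.
pose s := [:: edge_vx i, edge_vx (ord_pred i)
             & [seq copy_vx i j' | j' <- enum (predC1 j)]].
have -> : t + 2 = (size s).+1.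
  by rewrite /= size_map -cardE cardC1 card_ord; move: (ltn_ord j); lia.
move/(@b_vertex_leq_size _ _ _ _ s); apply; apply: svn_cycleP => // [i'|i' j'].
  rewrite adj_copy_edge eq_ordS_pred eq_sym !inE.
  by case/orP=> /eqP->; rewrite eqxx ?orbT.
rewrite adj_copy !inE /= => /andP[/eqP-> jj'].
by apply: map_f; rewrite mem_enum inE eq_sym.
Qed.

(** An edge vertex sees two roots and the two full copies associated with them. *)
Lemma b_vertex_edge k (f : G -> 'I_k) i :
  b_vertex f (edge_vx i) -> k <= 2 * t + 3.
Proof.
pose s := [:: root_vx i; root_vx (ordS i)] ++
  [seq copy_vx i j | j <- enum 'I_t] ++
  [seq copy_vx (ordS i) j | j <- enum 'I_t].
have -> : 2 * t + 3 = (size s).+1.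
  by rewrite !size_cat 2!size_map size_enum_ord /=; lia.
move/(@b_vertex_leq_size _ _ _ _ s); apply; apply: svn_cycleP => // [i'|i' j'].
  by rewrite adj_sym adj_root_edge !inE => /orP[]/eqP->; rewrite eqxx ?orbT.
rewrite adj_sym adj_copy_edge !inE mem_cat => /orP[]/eqP->.
  by rewrite map_f ?mem_enum ?orbT.
by rewrite [X in _ || X]orbC map_f ?mem_enum ?orbT.
Qed.

(** The bound puts the three cases of the final formula into one expression. *)
Lemma b_colorable_svn_cycle_leq k :
  0 < t -> b_colorable G k -> k <= minn (maxn (t + 2) n) (2 * t + 3).
Proof.
move=> t_gt0 /existsP[f /andP[_ /forallP fb]].
have [k_le|k_gt] := leqP k (t + 2); first by lia.
have edge_b c : exists i, (f (edge_vx i) == c) && b_vertex f (edge_vx i).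
  have /existsP[x] := fb c; move: x.
  apply: svn_cycleP => [i /andP[_ /b_vertex_root]|i ib|i j /andP[_ /b_vertex_copy]].
  - by lia.
  - by exists i.
  - by lia.
have k_le_n : k <= n.
  rewrite -[k]card_ord -[n]card_ord.
  (* Choosing an edge b-vertex for each color is injective, since the vertex determines its
     color. *)
  apply: (@leq_card _ _ (fun c => xchoose (edge_b c))) => c c' cc'.
  have /andP[/eqP <- _] := xchooseP (edge_b c).
  by have /andP[/eqP <- _] := xchooseP (edge_b c'); rewrite cc'.
have c0 : 'I_k by exists 0; lia.
have [i /andP[_ /b_vertex_edge]] := edge_b c0.
by lia.
Qed.

(** * Explicit colorings attaining the bounds *)

(* Edge vertex [i] has color [i] and copy [i] uses exactly the colors other
   than those of its two adjacent edge vertices, so all copy vertices are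
   b-vertices; copies 0, 1 and 2 together meet every color. *)
Lemma b_colorable_svn_cycle_small : 0 < t -> n <= t + 1 -> b_colorable G (t + 2).
Proof.
move=> t_gt0 n_le.
(* [C i] lists increasingly the colors other than [i] and [i - 1]; for [i = 0] the latter wraps
   around to [n - 1]. *)
pose C i j := if i == 0 then if j + 2 < n then j + 1 else j + 2
              else if j + 1 < i then j else j + 2.
apply: (@b_colorable_svn_cycle _ (fun i => C i 0) val (fun i j => C i j)).
- by move=> i; rewrite /C; move: (ltn_ord i); if_lia.
- by move=> i /=; move: (ltn_ord i); if_lia.
- by move=> i j; rewrite /C; move: (ltn_ord i) (ltn_ord j); if_lia.
- by move=> i; rewrite /C /=; move: (ltn_ord i); if_lia.
- by move=> i; rewrite val_ordS /C /=; move: (ltn_ord i); if_lia.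
- by move=> i j; rewrite /C /=; move: (ltn_ord i) (ltn_ord j); if_lia.
- by move=> i j; rewrite val_ordS /C /=; move: (ltn_ord i) (ltn_ord j); if_lia.
- by move=> i j j' /= jj'; apply: val_inj; move: jj'; rewrite /C /=; if_lia.
move=> c c_lt; right.
have [i [j Cij]] : exists i : 'I_n, exists j : 'I_t, C (ordS i) j = c.
  (* Copy 2 starts with color 0, copy 0 with color 1, and copy 1 has all colors from 2 on. *)
  have [i0 i1 in1] : [/\ 0 < n, 1 < n & n.-1 < n] by split; lia.
  have [->|c0] := eqVneq c 0.
    by exists (Ordinal i1), (Ordinal t_gt0); rewrite val_ordS /C /=; if_lia.
  have [->|c1] := eqVneq c 1.
    by exists (Ordinal in1), (Ordinal t_gt0); rewrite val_ordS /C /=; if_lia.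
  have j_lt : c - 2 < t by lia.
  by exists (Ordinal i0), (Ordinal j_lt); rewrite val_ordS /C /=; if_lia.
exists (i, j) => // c' c'_lt _.
have [->|c'i] := eqVneq c' i; first by constructor 1.
have [->|c'Si] := eqVneq c' (ordS i); first by constructor 2.
constructor 3; move: c'i c'Si; rewrite !val_ordS /= => c'i c'Si.
have i_lt := ltn_ord i.
(* [j'] inverts the increasing enumeration [C (ordS i)]. *)
pose j' := if i.+1 < n then if c' < i then c' else c' - 2
           else if c' < n.-1 then c' - 1 else c' - 2.
have j'_lt : j' < t by rewrite /j'; if_lia.
by exists (Ordinal j'_lt); rewrite /C /= /j'; if_lia.
Qed.

(* Colors are read modulo [k].  Edge vertex [i] gets color [c i], and copy [i]
   together with the root [i] gets the colors [c i + D] with [D] a subset of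
   [1, k - 2] that contains the odd numbers and [k - 2], so that [D] and
   [D + 1] cover [1, k - 1] and edge vertices 0, ..., k - 1 are b-vertices.
   Slot [t] of [D] is the root; it falls back to 1 when [D] is exhausted. *)
Lemma b_colorable_svn_cycle_large k :
  0 < t -> t + 2 <= k <= 2 * t + 3 -> k <= n -> b_colorable G k.
Proof.
move=> t_gt0 /andP[k_ge k_le] k_le_n.
pose c i := if i < k then i else 0.
(* The odd numbers come first, increasing, then the even ones, decreasing: a permutation of
   [1, k - 2], of which only slots 0 to [t] are used. *)
pose d j := if j < k - 2 then
              if 2 * j + 1 <= k - 2 then 2 * j + 1 else 2 * (k - 2 - j)
            else 1.
pose addk a b := if a + b < k then a + b else a + b - k.
(* Difference 0 would clash with edge vertex [i], and [k - 1], which is -1 modulo [k], with the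
   preceding one. *)
have dP j : 0 < d j < k - 1 by rewrite /d; if_lia.
have c_lt i : c i < k by rewrite /c; if_lia.
have addk_lt a b : a < k -> b < k -> addk a b < k by rewrite /addk; if_lia.
have neq_c i j : addk (c i) (d j) <> c i.
  by have := dP j; have := c_lt i; rewrite /addk; if_lia.
(* The second case covers the edge vertices from [k] on, all of color 0. *)
have cS (i : 'I_n) :
    c (ordS i) = addk (c i) 1 \/ c (ordS i) = 0 /\ c i = 0.
  by rewrite val_ordS /c /addk; move: (ltn_ord i); if_lia.
have neq_cS (i : 'I_n) j : addk (c (ordS i)) (d j) <> c i.
  have := dP j; have := c_lt i.
  by case: (cS i) => [->|[-> ->]]; rewrite /addk; if_lia.
apply: (@b_colorable_svn_cycle _ (fun i => addk (c i) (d t)) c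
                               (fun i j => addk (c i) (d j))).
- by move=> i; apply: addk_lt => //; have := dP t; if_lia.
- by move=> i.
- by move=> i j; apply: addk_lt => //; have := dP j; if_lia.
- by move=> i; apply: neq_c.
- by move=> i; apply: neq_cS.
- by move=> i j; apply: neq_c.
- by move=> i j; apply: neq_cS.
- move=> i j j' /= jj'; apply: val_inj; have ddj : d j = d j'.
    by move: jj'; have := dP j; have := dP j'; have := c_lt i; rewrite /addk; if_lia.
  by move: ddj; rewrite /d /=; move: (ltn_ord j) (ltn_ord j'); if_lia.
move=> a a_lt; left; have a_lt_n : a < n by lia.
have ca : c a = a by rewrite /c a_lt.
exists (Ordinal a_lt_n) => // a' a'_lt a'a.
have cSa : c (ordS (Ordinal a_lt_n)) = addk a 1.
  by rewrite val_ordS /c /addk /=; if_lia.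
pose delta := if a < a' then a' - a else a' + k - a.
have [j j_le dj] : exists2 j, j <= t & d j = delta \/ (d j).+1 = delta.
  have delta_lt : 0 < delta < k by rewrite /delta; if_lia.
  clearbody delta.
  (* Below [k - 1], an odd [delta] is itself in the pattern and an even one follows an odd one. The
     value [k - 1] follows [k - 2], which sits in slot [(k - 2)./2] for either parity. *)
  have [lt_k1|ge_k1] := ltnP delta (k - 1).
    by exists (delta.-1)./2; rewrite /d; if_lia.
  by exists (k - 2)./2; rewrite /d; if_lia.
(* A difference equal to [delta] gives color [a'] at index [a]; one short of [delta] gives it at the
   next index, whose base color is one higher. *)
have a'E : a' = addk (c a) (d j) \/
           a' = addk (c (ordS (Ordinal a_lt_n))) (d j).
  rewrite ca cSa; have := dP j.
  by move: dj; rewrite /delta /addk; case=> dj; [left|right]; if_lia.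
have [j_lt|t_le_j] := ltnP j t.
  by case: a'E => a'E; [constructor 3|constructor 4]; exists (Ordinal j_lt).
have jt : j = t by lia.
by rewrite jt in a'E; case: a'E => ->; [constructor 1|constructor 2].
Qed.

End CycleCorona.

(** * The b-chromatic number in the three ranges *)

Theorem theorem14 (n t : nat) (hn : 2 < n) (ht : 0 < t) :
  b_chromatic (svn_corona (cycle_graph n) (complete_graph t)) =
  if n <= t + 1 then t + 2
  else if t + 2 <= n <= 2 * t + 3 then n
  else 2 * t + 3.
Proof.
have ub := b_colorable_svn_cycle_leq hn ht (b_chromatic_attained _).
apply/eqP; rewrite eqn_leq; apply/andP; split; first by move: ub; if_lia.
case: ifP => [n_le|n_gt].
  by apply/leq_b_chromatic/b_colorable_svn_cycle_small.
by case: ifP => [n_range|n_gt']; apply/leq_b_chromatic;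
   apply: b_colorable_svn_cycle_large => //; lia.
Qed.
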